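(* Let $q(P)=\|P\|$ be a norm on $\mathbb{P}(\mathbb{C}^N)$ with $q\in\mathcal{KL}$. Then the following two conditions are equivalent: (1) $q\in\mathcal{VM}$; (2) $q\in\mathcal{AM}$ and there is a constant $A>0$ such that $M_q(n,n)\le A^n\, n!$ for all integers $n\ge 1$.
   Context: $\mathbb{P}(\mathbb{C}^N)$ is the vector space of polynomials in $N$ variables with complex coefficients. For a norm $q(P)=\|P\|$ on $\mathbb{P}(\mathbb{C}^N)$ and integers $1\le k\le n$ put $$M_q(n,k)=\sup\{\|D^\alpha P\|:\ |\alpha|=k,\ k\le\deg P\le n,\ \|P\|=1\}.$$ A triangular array of positive numbers $\varphi(n,k)$, $1\le k\le n$, $n\in\{1,2,\dots\}$, belongs to the Kolmogorov-Landau class $\mathcal{KL}$ if, with $\psi(n,k):=\varphi(n,k)^{1/k}$, there is a constant $C>0$ such that for all $n>1$ and all $1\le k\le n$ $$\log\psi(n,k)\le \log C+\left(1-\frac{\log k}{\log n}\right)\log\psi(n,1)+\frac{\log k}{\log n}\log\psi(n,n).$$ One writes $q\in\mathcal{KL}$ if the array $M_q(n,k)$ belongs to $\mathcal{KL}$. One writes $q\in\mathcal{AM}$ (A. Markov property) if there are constants $M>0$, $m\ge1$ with $M_q(n,1)\le M n^m$ for all $n\ge 1$. One writes $q\in\mathcal{VM}$ (V. Markov property) if there are constants $M>0$, $m\ge 1$ with $M_q(n,k)\le M^k n^{km}/(k!)^{m-1}$ for all $1\le k\le n$. *)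

(* Defs.v *)
From HB Require Import structures.
From mathcomp Require Import all_boot all_order all_algebra.
From mathcomp Require Import complex.
From mathcomp Require Import classical_sets reals exp.
(* The notations of [mpoly] clash with those of analysis. *)
From mathcomp Require Import -(notations) mpoly.

Set Implicit Arguments.
Unset Strict Implicit.
Unset Printing Implicit Defensive.

Import Order.TTheory GRing.Theory Num.Theory.

Local Open Scope classical_set_scope.
Local Open Scope ring_scope.

Notation cpoly R N := (mpoly N R[i]).

Section Norms.
Variables (R : realType) (N : nat).
Implicit Types (q : cpoly R N -> R) (P : cpoly R N).

Definition tdeg P : nat := (mmeasure mdeg P).-1.

Definition multi_deriv (a : multinom N) P : cpoly R N :=
  mderivm a P.

(* Nonnegativity of [q] follows from the first two clauses. *)
Definition is_norm q : Prop :=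
  [/\ forall P (Q : cpoly R N), q (P + Q) <= q P + q Q,
      forall (c : R[i]) P, q (c *: P) = Normc.normc c * q P
    & forall P, q P = 0 -> P = 0].

(* For a norm [q] and [1 <= k <= n] the set below is bounded (the polynomials
   of degree at most [n] form a finite-dimensional space), and it is nonempty
   when [0 < N], so that the real [sup] is the genuine supremum. *)
Definition M_ q (n k : nat) : R :=
  sup [set x : R | exists (a : multinom N) P,
    [/\ mdeg a = k, (k <= tdeg P <= n)%N, q P = 1
      & x = q (multi_deriv a P)]].

End Norms.

Section Classes.
Variable R : realType.
Implicit Type phi : nat -> nat -> R.

Definition root_array phi (n k : nat) : R := phi n k `^ k%:R^-1.

(* Only the entries [phi n k] with [1 <= k <= n] matter; the first clause says
   that [phi] is an array of positive numbers. *)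
Definition KL_array phi : Prop :=
  (forall n k : nat, (1 <= k <= n)%N -> 0 < phi n k) /\
  exists2 C : R, 0 < C &
    forall n k : nat, (1 < n)%N -> (1 <= k <= n)%N ->
      ln (root_array phi n k) <=
        ln C + (1 - ln k%:R / ln n%:R) * ln (root_array phi n 1)
             + ln k%:R / ln n%:R * ln (root_array phi n n).

End Classes.

Section NormClasses.
Variables (R : realType) (N : nat).
Implicit Type q : cpoly R N -> R.

Definition KL q : Prop := KL_array (M_ q).

Definition AM q : Prop :=
  exists M m : R, [/\ 0 < M, 1 <= m &
    forall n : nat, (1 <= n)%N -> M_ q n 1 <= M * n%:R `^ m].

Definition VM q : Prop :=
  exists M m : R, [/\ 0 < M, 1 <= m &
    forall n k : nat, (1 <= k <= n)%N ->
      M_ q n k <= M ^+ k * n%:R `^ (k%:R * m) / k`!%:R `^ (m - 1)].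

End NormClasses.

(* Main.v *)
Require Import Defs.
From HB Require Import structures.
From mathcomp Require Import all_boot all_order all_algebra.
From mathcomp Require Import complex.
From mathcomp Require Import classical_sets reals exp.
From mathcomp Require Import -(notations) mpoly.
From mathcomp Require Import sequences(expR).
From mathcomp Require Import ring lra.

Import Order.TTheory GRing.Theory Num.Theory.

Local Open Scope ring_scope.

(** Both implications are statements about the array [phi n k = M_ q n k].
    Taking logarithms makes every condition linear in [ln (phi n k)]: with
    [L k := ln (phi n k) / k] and [t := ln k / ln n], the class [KL] says
    [L k <= ln C + (1 - t) * L 1 + t * L n] for [n > 1].

    From the V. Markov bound, the A. Markov bound is the column [k = 1]; the
    diagonal [k = n] gives [M ^ n * n! * (n ^ n / n!) ^ m], and
    [n ^ n / n! <= e ^ n] ([ln_fact_ge]).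

    Conversely, the A. Markov bound says [L 1 <= ln M + m * ln n] and, since
    [n! <= n ^ n] ([ln_fact_le]), the diagonal bound says
    [L n <= ln A + ln n].  Interpolating, and using [t * ln n = ln k], gives
    [L k <= const + m * ln n - (m - 1) * ln k]; multiplying by [k] and
    replacing [k * ln k] by the smaller [ln k!] is the V. Markov bound. *)

Lemma ln_factS (R : realType) (n : nat) :
  ln (n.+1`!%:R : R) = ln n.+1%:R + ln n`!%:R.
Proof. by rewrite factS natrM lnM ?posrE ?ltr0n ?fact_gt0. Qed.

Lemma ln_fact_le (R : realType) (n : nat) :
  ln (n`!%:R : R) <= n%:R * ln n%:R.
Proof.
elim: n => [|n IHn]; first by rewrite fact0 ln1 mul0r.
have ln_le : (n%:R * ln n%:R : R) <= n%:R * ln n.+1%:R.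
  case: n {IHn} => [|n]; first by rewrite !mul0r.
  by apply: ler_wpM2l => //; rewrite ler_ln ?posrE ?ltr0n // ler_nat.
rewrite ln_factS -[X in _ <= X * _]natr1; lra.
Qed.

(** The elementary half of Stirling's formula, [n ^ n / n! <= e ^ n]; the
    increment in [n] is [ln (1 + 1 / n) <= 1 / n]. *)
Lemma ln_fact_ge (R : realType) (n : nat) :
  n%:R * ln n%:R - n%:R <= ln (n`!%:R : R).
Proof.
elim: n => [|[|n] IHn]; first by rewrite fact0 ln1 mul0r subr0.
  by rewrite ln1 mulr0 sub0r lerN10.
set x : R := n.+1%:R in IHn *.
have x_gt0 : 0 < x by rewrite ltr0n.
have succE : n.+2%:R = x + 1 :> R by rewrite natr1.
have incr : x * (ln (x + 1) - ln x) <= 1.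
  rewrite -ln_div ?posrE //; last by rewrite addr_gt0.
  rewrite mulrDl mulfV ?gt_eqF // mul1r -[leRHS](mulfV (lt0r_neq0 x_gt0)).
  rewrite ler_pM2l //; apply: le_ln1Dx.
  by rewrite (lt_trans _ (_ : 0 < x^-1)) ?invr_gt0 ?ltrN10.
rewrite ln_factS succE; lra.
Qed.

Lemma VM_bound_gt0 (R : realType) (M m : R) (n k : nat) :
  0 < M -> (0 < n)%N ->
  0 < M ^+ k * n%:R `^ (k%:R * m) / k`!%:R `^ (m - 1).
Proof.
move=> M0 n0.
by rewrite divr_gt0 ?mulr_gt0 ?exprn_gt0 ?powR_gt0 ?ltr0n ?fact_gt0.
Qed.

Lemma ln_VM_bound (R : realType) (M m : R) (n k : nat) :
  0 < M -> (0 < n)%N ->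
  ln (M ^+ k * n%:R `^ (k%:R * m) / k`!%:R `^ (m - 1)) =
    k%:R * (ln M + m * ln n%:R) - (m - 1) * ln k`!%:R.
Proof.
move=> M0 n0.
rewrite ln_div ?lnM ?posrE ?mulr_gt0 ?exprn_gt0 ?powR_gt0 ?ltr0n ?fact_gt0 //.
by rewrite lnXn // !ln_powR -mulr_natl; ring.
Qed.

(** The left-hand side is [M ^ n * n! * (n ^ n / n!) ^ m]; the factor [expR m]
    comes from [n ^ n / n! <= e ^ n]. *)
Lemma diagonal_bound_of_VM (R : realType) (M m : R) (n : nat) :
  0 < M -> 1 <= m -> (0 < n)%N ->
  M ^+ n * n%:R `^ (n%:R * m) / n`!%:R `^ (m - 1) <=
    (M * expR m) ^+ n * n`!%:R.
Proof.
move=> M0 m1 n0.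
have nfact0 : 0 < n`!%:R :> R by rewrite ltr0n fact_gt0.
have Mm0 : 0 < M * expR m by rewrite mulr_gt0 ?expR_gt0.
rewrite -ler_ln ?posrE ?VM_bound_gt0 ?mulr_gt0 ?exprn_gt0 //.
rewrite ln_VM_bound // [leRHS]lnM ?posrE ?exprn_gt0 // lnXn //.
rewrite lnM ?posrE ?expR_gt0 // expRK -(mulr_natl (_ + _)).
have : m * (n%:R * ln n%:R - n%:R) <= m * ln n`!%:R.
  by rewrite ler_wpM2l ?(le_trans ler01) ?ln_fact_ge.
lra.
Qed.

(** Since [t * ln n = ln k], interpolating [m * ln n] (at [k = 1]) with [ln n]
    (at [k = n]) yields exactly [m * ln n - (m - 1) * ln k]: the exponents of
    [n] and of [k!] in the V. Markov bound, per derivative. *)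
Lemma VM_of_KL (R : realType) (phi : nat -> nat -> R) (M m A : R) :
  KL_array phi -> 0 < M -> 1 <= m -> 0 < A ->
  (forall n, (1 <= n)%N -> phi n 1 <= M * n%:R `^ m) ->
  (forall n, (1 <= n)%N -> phi n n <= A ^+ n * n`!%:R) ->
  exists2 B : R, 0 < B & forall n k, (1 <= k <= n)%N ->
    phi n k <= B ^+ k * n%:R `^ (k%:R * m) / k`!%:R `^ (m - 1).
Proof.
move=> [phi0 [C C0 phiKL]] M0 m1 A0 phi1 phin.
(* Absolute values let one constant dominate [ln C] plus any convex combination
   of [ln M] and [ln A], and also [ln M] alone: interpolation starts at
   [n = 2], and for [n = 1] the A. Markov bound is used directly. *)
pose c := `|ln C| + `|ln M| + `|ln A|.
exists (expR c) => [|n k]; first exact: expR_gt0.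
move=> /andP[k0 kn]; have n0 := leq_trans k0 kn.
have posN j : (0 < j)%N -> 0 < j%:R :> R by rewrite ltr0n.
rewrite -ler_ln ?posrE ?VM_bound_gt0 ?expR_gt0 ?phi0 ?k0 //.
rewrite ln_VM_bound ?expR_gt0 // expRK.
have C_le := ler_norm (ln C); have C_ge := normr_ge0 (ln C).
have M_le := ler_norm (ln M); have M_ge := normr_ge0 (ln M).
have A_le := ler_norm (ln A); have A_ge := normr_ge0 (ln A).
have L1 : ln (phi n 1) <= ln M + m * ln n%:R.
  rewrite -ln_powR -lnM ?posrE ?powR_gt0 ?posN //.
  by rewrite ler_ln ?posrE ?phi0 ?mulr_gt0 ?powR_gt0 ?posN ?phi1.
have [n1|n_le1] := ltnP 1 n; last first.
  have -> : k = 1%N by apply/eqP; rewrite eqn_leq k0 (leq_trans kn).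
  rewrite ln1 mulr0 subr0 mul1r (le_trans L1) // lerD2r /c; lra.
have Ln : n%:R^-1 * ln (phi n n) <= ln A + ln n%:R.
  rewrite mulrC ler_pdivrMr ?posN //.
  have : ln (phi n n) <= ln (A ^+ n * n`!%:R).
    rewrite ler_ln ?posrE ?phi0 ?n0 ?leqnn ?phin //.
    by rewrite mulr_gt0 ?exprn_gt0 ?posN ?fact_gt0.
  rewrite lnM ?posrE ?exprn_gt0 ?posN ?fact_gt0 // lnXn // -(mulr_natl (ln A)).
  have := ln_fact_le R n; lra.
have lnn0 : 0 < ln n%:R :> R by rewrite ln_gt0 // ltr1n.
have lnk0 : 0 <= ln k%:R :> R by rewrite ln_ge0 // ler1n.
have := phiKL n k n1; rewrite k0 kn => /(_ isT).
rewrite /root_array !ln_powR invr1 mul1r.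
set t := ln k%:R / ln n%:R => Lk.
have tE : t * ln n%:R = ln k%:R by rewrite divfK ?gt_eqF.
have t0 : 0 <= t by rewrite divr_ge0 // ltW.
have t1 : t <= 1 by rewrite ler_pdivrMr // mul1r ler_ln ?posrE ?posN ?ler_nat.
have Lk_le : k%:R^-1 * ln (phi n k) <= c + m * ln n%:R - (m - 1) * ln k%:R.
  have L1t : (1 - t) * ln (phi n 1) <= (1 - t) * (ln M + m * ln n%:R).
    by rewrite ler_wpM2l ?subr_ge0.
  have Lnt : t * (n%:R^-1 * ln (phi n n)) <= t * (ln A + ln n%:R).
    by rewrite ler_wpM2l.
  have Mt : (1 - t) * ln M <= `|ln M| by nra.
  have At : t * ln A <= `|ln A| by nra.
  have interp : m * ln n%:R - (m - 1) * ln k%:R =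
            (1 - t) * (m * ln n%:R) + t * ln n%:R by rewrite -tE; ring.
  rewrite /c; lra.
move: Lk_le; rewrite mulrC ler_pdivrMr ?posN // => /le_trans; apply.
have : (m - 1) * ln k`!%:R <= (m - 1) * (k%:R * ln k%:R).
  by rewrite ler_wpM2l ?subr_ge0 ?ln_fact_le.
lra.
Qed.

Theorem theorem6p7 (R : realType) (N : nat) (q : cpoly R N -> R)
    (N_gt0 : (0 < N)%N) (q_norm : is_norm q) (q_KL : KL q) :
  VM q <->
  (AM q /\
   exists2 A : R, 0 < A &
     forall n : nat, (1 <= n)%N -> M_ q n n <= A ^+ n * n`!%:R).
Proof.
split=> [[M [m [M0 m1 qVM]]]|[[M [m [M0 m1 qAM]]] [A A0 qdiag]]].
  split.
    exists M, m; split=> // n n0; have := qVM n 1%N; rewrite n0 => /(_ isT).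
    by rewrite expr1 mul1r factS fact0 powR1 divr1.
  exists (M * expR m) => [|n n0]; first by rewrite mulr_gt0 ?expR_gt0.
  apply: le_trans (diagonal_bound_of_VM _ _ _ _ M0 m1 n0).
  by apply: qVM; rewrite n0 leqnn.
have [B B0 qVM] := VM_of_KL _ _ _ _ _ q_KL M0 m1 A0 qAM qdiag.
by exists B, m.
Qed.
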